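(* Let $\Gamma=\langle\mathcal{A},\mathcal{R}\rangle$ be an AFRA which is an AF, i.e. $\mathcal{R}\subseteq\mathcal{A}\times\mathcal{A}$, and let $\mathcal{S}\subseteq\mathcal{A}\cup\mathcal{R}$. Then $\mathcal{S}$ is a semi-stable extension of $\Gamma$ if and only if $\mathcal{S}=\mathcal{U}^{\rightarrow AFRA}$ for some $\mathcal{U}\subseteq\mathcal{A}$ which is a D-semi-stable extension of $\Gamma$.
   Context: An AFRA (Argumentation Framework with Recursive Attacks) is a pair $\langle\mathcal{A},\mathcal{R}\rangle$ where $\mathcal{A}$ is a set (of arguments) and $\mathcal{R}$ is a set of attacks, each attack being a pair $\alpha=(A,X)$ with $A\in\mathcal{A}$ and ($X\in\mathcal{R}$ or $X\in\mathcal{A}$); $A=src(\alpha)$ is its source and $X=trg(\alpha)$ its target. Arguments and attacks are distinct objects ($\mathcal{A}\cap\mathcal{R}=\emptyset$). Defeat: for $\alpha\in\mathcal{R}$, $V\in\mathcal{A}\cup\mathcal{R}$, $\alpha$ directly defeats $V$ iff $V=trg(\alpha)$; $\alpha$ indirectly defeats $\beta\in\mathcal{R}$ iff $\alpha$ directly defeats $src(\beta)$; $\alpha\rightarrow_R V$ ($\alpha$ defeats $V$) iff $\alpha$ directly or indirectly defeats $V$. Only attacks can defeat. A set $\mathcal{S}\subseteq\mathcal{A}\cup\mathcal{R}$ is conflict-free iff there are no $V,W\in\mathcal{S}$ with $V\rightarrow_R W$. $W\in\mathcal{A}\cup\mathcal{R}$ is acceptable w.r.t. $\mathcal{S}$ iff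 for every $\alpha\in\mathcal{R}$ with $\alpha\rightarrow_R W$ there is $\beta\in\mathcal{S}$ with $\beta\rightarrow_R\alpha$. $\mathcal{S}$ is admissible iff it is conflict-free and each of its elements is acceptable w.r.t. $\mathcal{S}$. $\mathcal{S}$ is a complete extension iff it is admissible and contains every element of $\mathcal{A}\cup\mathcal{R}$ acceptable w.r.t. $\mathcal{S}$. The range of $\mathcal{S}$ is $range(\mathcal{S})=\mathcal{S}\cup\{V\in\mathcal{A}\cup\mathcal{R}\mid\exists\alpha\in\mathcal{S},\ \alpha\rightarrow_R V\}$. $\mathcal{S}$ is a semi-stable extension iff it is a complete extension whose range is maximal (w.r.t. set inclusion) among the ranges of complete extensions. Dung notions (for $\Gamma$ viewed as a Dung argumentation framework with set of arguments $\mathcal{A}$ and attack relation $\mathcal{R}\subseteq\mathcal{A}\times\mathcal{A}$): $\mathcal{U}\subseteq\mathcal{A}$ is D-conflict-free if there are no $A,B\in\mathcal{U}$ with $(A,B)\in\mathcal{R}$; $A\in\mathcal{A}$ is D-acceptable w.r.t. $\mathcal{U}$ if for all $B\in\mathcal{A}$ with $(B,A)\in\mathcal{R}$ there is $C\in\mathcal{U}$ with $(C,B)\in\mathcal{R}$; $\mathcal{U}$ is D-admissible if it is D-conflict-free and each of its elements is D-acceptable w.r.t. $\mathcal{U}$; $\mathcal{U}$ is a D-complete extension if it is D-admissible and contains every argument D-acceptable w.r.t. $\mathcal{U}$; $Drange(\mathcal{U})=\mathcal{U}\cup\{A\in\mathcal{A}\mid\exists B\in\mathcal{U},\ (B,A)\in\mathcal{R}\}$;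 $\mathcal{U}$ is a D-semi-stable extension if it is a D-complete extension whose $Drange$ is maximal (w.r.t. set inclusion) among those of D-complete extensions. For $\mathcal{U}\subseteq\mathcal{A}$, $\mathcal{U}^{\rightarrow AFRA}:=\mathcal{U}\cup\{\alpha\in\mathcal{R}\mid src(\alpha)\in\mathcal{U}\}$. *)

(* Defs.v *)
From mathcomp Require Import all_boot classical_sets.
Set Implicit Arguments.
Unset Strict Implicit.
Unset Printing Implicit Defensive.
Local Open Scope classical_set_scope.

(** Argumentation frameworks with recursive attacks, over a type [T] from which
    arguments are drawn.  The framework may be infinite. *)

(** An attack is a pair of an argument and either an argument or an attack.
    As it is nothing but this pair, two attacks with the same source and
    the same target are equal, and the recursion is well founded. *)
Inductive attack (T : Type) : Type := Attack { src : T; trg : T + attack T }.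

Notation element T := (T + attack T)%type.

(** [A `|` R] as a subset of the disjoint sum, so that arguments and attacks
    are distinct objects. *)
Definition AR (T : Type) (A : set T) (R : set (attack T)) : set (element T) :=
  inl @` A `|` inr @` R.

Record afra (T : Type) := Afra {
  args : set T;
  atts : set (attack T);
  atts_wf : forall alpha, atts alpha ->
    args (src alpha) /\ AR args atts (trg alpha)
}.

Definition elements T (G : afra T) : set (element T) := AR (args G) (atts G).

Definition is_AF T (G : afra T) : Prop :=
  atts G `<=` [set Attack a (inl b) | a in args G & b in args G].

Section AFRA.
Context {T : Type} (G : afra T).
Implicit Types (S : set (element T)) (alpha beta : attack T) (V W : element T).

Definition directly_defeats alpha V : Prop :=
  [/\ atts G alpha, elements G V & V = trg alpha].

Definition indirectly_defeats alpha beta : Prop :=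
  [/\ atts G alpha, atts G beta & directly_defeats alpha (inl (src beta))].

Definition defeats alpha V : Prop :=
  directly_defeats alpha V \/
  exists2 beta, V = inr beta & indirectly_defeats alpha beta.

Definition conflict_free S : Prop :=
  S `<=` elements G /\
  ~ exists alpha W, [/\ S (inr alpha), S W & defeats alpha W].

Definition acceptable S W : Prop :=
  elements G W /\
  forall alpha, atts G alpha -> defeats alpha W ->
    exists2 beta, S (inr beta) & defeats beta (inr alpha).

Definition admissible S : Prop :=
  conflict_free S /\ forall V, S V -> acceptable S V.

Definition complete S : Prop :=
  admissible S /\ forall V, elements G V -> acceptable S V -> S V.

Definition AFRA_range S : set (element T) :=
  S `|` [set V | elements G V /\ exists2 alpha, S (inr alpha) & defeats alpha V].

Definition semi_stable S : Prop :=
  complete S /\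
  forall S', complete S' ->
    AFRA_range S `<=` AFRA_range S' -> AFRA_range S' = AFRA_range S.

End AFRA.

(** Dung's notions, for [G] viewed as the directed graph on [args G] whose edges
    are the attacks between arguments. *)
Section Dung.
Context {T : Type} (G : afra T).
Implicit Types (U : set T) (a b c : T).

Definition D_attacks a b : Prop := atts G (Attack a (inl b)).

Definition D_conflict_free U : Prop :=
  U `<=` args G /\ ~ exists a b, [/\ U a, U b & D_attacks a b].

Definition D_acceptable U a : Prop :=
  args G a /\
  forall b, args G b -> D_attacks b a -> exists2 c, U c & D_attacks c b.

Definition D_admissible U : Prop :=
  D_conflict_free U /\ forall a, U a -> D_acceptable U a.

Definition D_complete U : Prop :=
  D_admissible U /\ forall a, args G a -> D_acceptable U a -> U a.

Definition D_range U : set T :=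
  U `|` [set a | args G a /\ exists2 b, U b & D_attacks b a].

Definition D_semi_stable U : Prop :=
  D_complete U /\
  forall U', D_complete U' -> D_range U `<=` D_range U' -> D_range U' = D_range U.

Definition to_AFRA U : set (element T) :=
  inl @` U `|` inr @` [set alpha | atts G alpha /\ U (src alpha)].

End Dung.

(* Main.v *)
Require Import Defs.
From mathcomp Require Import all_boot classical_sets.
Local Open Scope classical_set_scope.

(** In an AF, whether an element is defeated depends only on its underlying
    argument: the argument itself, or the source if it is an attack.  So does
    acceptability; hence a complete extension [S] is [to_AFRA G U] for the set
    [U] of its arguments, and its range is the preimage of [D_range G U] under
    the underlying-argument map.  Completeness and inclusion of ranges therefore
    transfer between [U] and [to_AFRA G U]. *)

Definition underlying_arg {T : Type} (W : element T) : T :=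
  match W with inl a => a | inr beta => src beta end.

Lemma elements_inl (T : Type) (G : afra T) (a : T) :
  elements G (inl a) <-> args G a.
Proof.
split=> [[[b Ab [<-]] //|[b _] //]|Aa].
by left; exists a.
Qed.

Lemma elements_inr (T : Type) (G : afra T) (alpha : attack T) :
  elements G (inr alpha) <-> atts G alpha.
Proof.
split=> [[[b _] //|[b Rb [<-]] //]|Ra].
by right; exists alpha.
Qed.

Lemma args_underlying (T : Type) (G : afra T) (W : element T) :
  elements G W -> args G (underlying_arg W).
Proof.
case: W => [a|beta] /=; first by move/elements_inl.
by move/elements_inr/atts_wf => [].
Qed.

(** Merging the two halves of the union into one condition on [underlying_arg] spares later proofs
    the case split between arguments and attacks. *)
Lemma to_AFRAP (T : Type) (G : afra T) (U : set T) (W : element T) :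
  U `<=` args G ->
  to_AFRA G U W <-> elements G W /\ U (underlying_arg W).
Proof.
move=> UA; case: W => [a|beta] /=.
- split=> [[[b Ub [<-]]|[b _] //]|[_ Ua]]; last by left; exists a.
  by split=> //; apply/elements_inl/UA.
- split=> [[[b _] //|[b [Rb Ub] [<-]]]|[/elements_inr Rb Ub]].
    by split=> //; apply/elements_inr.
  by right; exists beta.
Qed.

Section AF.
Context {T : Type} {G : afra T} (hG : is_AF G).
Implicit Types (U : set T) (S : set (element T)).

(** In an AF every target is an argument. A direct defeat therefore hits an argument, and an
    indirect one hits the source of an attack: one equation covers both. *)
Lemma defeatsP (alpha : attack T) (W : element T) :
  defeats G alpha W <->
  [/\ atts G alpha, elements G W & trg alpha = inl (underlying_arg W)].
Proof.
split.
  case=> [[Ra EW WE]|[beta -> [Ra Rb [_ _ <-]]]]; last first.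
    by split=> //; apply/elements_inr.
  (* Here [W] is itself the target, so [hG] makes it an argument, equal to
     [inl (underlying_arg W)]. *)
  split=> //; have [a _ [b _ abE]] := hG _ Ra.
  by rewrite WE -abE.
case: W => [b|beta] /= [Ra EW tE]; first by left.
right; exists beta => //; have /elements_inr Rb := EW.
by split=> //; split=> //; apply/elements_inl; have [] := atts_wf Rb.
Qed.

Lemma defeats_D_attacks (alpha : attack T) (W : element T) :
  defeats G alpha W -> D_attacks G (src alpha) (underlying_arg W).
Proof. by case: alpha => a t /defeatsP[Ra _ /= tE]; rewrite /D_attacks -tE. Qed.

Lemma D_attacks_defeats (a : T) (W : element T) : elements G W ->
  D_attacks G a (underlying_arg W) ->
  defeats G (Attack a (inl (underlying_arg W))) W.
Proof. by move=> EW Ra; apply/defeatsP. Qed.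

(** By [defeatsP], [V] and [W] have the same defeaters, so whatever defends one defends the
    other. *)
Lemma acceptable_underlying S (V W : element T) :
  elements G W -> underlying_arg V = underlying_arg W ->
  acceptable G S V -> acceptable G S W.
Proof.
move=> EW VW [EV accV]; split=> // alpha Ra /defeatsP[_ _ tE].
by apply: accV => //; apply/defeatsP; rewrite VW.
Qed.

Lemma complete_to_AFRA S : complete G S ->
  S = to_AFRA G [set a | S (inl a)].
Proof.
move=> [[[SE _] adm] compl].
have SA : [set a | S (inl a)] `<=` args G.
  by move=> a /SE /elements_inl.
apply/seteqP; split=> W.
  move=> SW; apply/to_AFRAP => //; split; first exact: SE.
  (* Acceptability passes from [W] to its underlying argument, which completeness then puts into
     [S]; the converse inclusion runs the other way. *)
  have EA : elements G (inl (underlying_arg W)).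
    by apply/elements_inl/args_underlying/SE.
  by apply: compl => //; apply: (@acceptable_underlying _ W) => //; apply: adm.
move=> /(to_AFRAP _ _ _ _ SA)[EW SW]; apply: compl => //.
by apply: acceptable_underlying (adm _ SW).
Qed.

Lemma acceptable_to_AFRA U (W : element T) : U `<=` args G -> elements G W ->
  acceptable G (to_AFRA G U) W <-> D_acceptable G U (underlying_arg W).
Proof.
move=> UA EW; split=> [[_ acc]|[_ acc]].
  split=> [|b Ab ab]; first exact: args_underlying.
  have [beta /(to_AFRAP _ _ _ _ UA)[_ Ub] /defeats_D_attacks bD] :=
    acc _ ab (D_attacks_defeats _ _ EW ab).
  by exists (src beta).
split=> // alpha Ra /defeats_D_attacks aW.
have [c Uc cD] := acc _ (proj1 (atts_wf Ra)) aW.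
(* The defence against [alpha] is indirect: it strikes the source of [alpha]. *)
exists (Attack c (inl (src alpha))).
  by apply/to_AFRAP => //; split=> //; apply/elements_inr.
have EA : elements G (inr alpha) by apply/elements_inr.
exact: (D_attacks_defeats _ (inr alpha)).
Qed.

Lemma conflict_free_to_AFRA U : U `<=` args G ->
  conflict_free G (to_AFRA G U) <-> D_conflict_free G U.
Proof.
move=> UA; split=> [[_ cf]|[_ cf]]; split=> //.
- move=> [a [b [Ua Ub ab]]]; apply: cf.
  have Eb : elements G (inl b) by apply/elements_inl/UA.
  exists (Attack a (inl b)), (inl b); split.
  + by apply/to_AFRAP => //; split=> //; apply/elements_inr.
  + exact/to_AFRAP.
  + exact: (D_attacks_defeats _ (inl b)).
- by move=> W /(to_AFRAP _ _ _ _ UA)[].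
- move=> [alpha [W [/(to_AFRAP _ _ _ _ UA)[_ Ua] /(to_AFRAP _ _ _ _ UA)[_ UW]]]].
  move=> /defeats_D_attacks aW; apply: cf.
  by exists (src alpha), (underlying_arg W).
Qed.

Lemma complete_D_complete U : U `<=` args G ->
  complete G (to_AFRA G U) <-> D_complete G U.
Proof.
move=> UA; split=> [[[cf adm] compl]|[[cf adm] compl]].
- split; first split; first exact/conflict_free_to_AFRA.
  + move=> a Ua; have Ea : elements G (inl a) by apply/elements_inl/UA.
    by apply/(acceptable_to_AFRA _ (inl a)) => //; apply/adm/to_AFRAP.
  + move=> a /elements_inl Ea acc.
    have /(to_AFRAP _ _ _ _ UA)[] // : to_AFRA G U (inl a).
    by apply: compl => //; apply/acceptable_to_AFRA.
- split; first split; first exact/conflict_free_to_AFRA.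
  + move=> W /(to_AFRAP _ _ _ _ UA)[EW UW].
    by apply/acceptable_to_AFRA => //; apply: adm.
  + move=> W EW /(acceptable_to_AFRA _ _ UA EW) acc; apply/to_AFRAP => //.
    by split=> //; apply: compl => //; apply: args_underlying.
Qed.

Lemma AFRA_range_to_AFRA U : U `<=` args G ->
  AFRA_range G (to_AFRA G U) =
  [set W | elements G W /\ D_range G U (underlying_arg W)].
Proof.
move=> UA; apply/seteqP; split=> W.
  case=> [/(to_AFRAP _ _ _ _ UA)[EW UW]|[EW [alpha]]].
    by split=> //; left.
  move=> /(to_AFRAP _ _ _ _ UA)[_ Ua] /defeats_D_attacks aW.
  split=> //; right; split; first exact: args_underlying.
  by exists (src alpha).
move=> [EW [UW|[_ [b Ub bW]]]]; first by left; apply/to_AFRAP.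
right; split=> //; exists (Attack b (inl (underlying_arg W))).
  by apply/to_AFRAP => //; split=> //; apply/elements_inr.
exact: D_attacks_defeats.
Qed.

(** Both ranges are preimages under [underlying_arg], and each argument [a] is the image of [inl a],
    so inclusion is reflected as well as preserved. *)
Lemma AFRA_range_sub U U' : U `<=` args G -> U' `<=` args G ->
  AFRA_range G (to_AFRA G U) `<=` AFRA_range G (to_AFRA G U') <->
  D_range G U `<=` D_range G U'.
Proof.
move=> UA UA'; rewrite !AFRA_range_to_AFRA //; split=> sub.
  move=> a Ua; have Ea : elements G (inl a).
    by apply/elements_inl; case: Ua => [/UA|[]].
  by have [] := sub (inl a) (conj Ea Ua).
by move=> W [EW UW]; split=> //; apply: sub.
Qed.

Lemma semi_stable_to_AFRA U : U `<=` args G ->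
  semi_stable G (to_AFRA G U) <-> D_semi_stable G U.
Proof.
move=> UA; split=> [[cS mx]|[cU mx]].
  split=> [|U' cU' sub]; first exact/complete_D_complete.
  have UA' : U' `<=` args G by case: cU' => [[[]]].
  (* Only the inclusion opposite to [sub] remains; on the AFRA side maximality turns it into a
     reflexive one. *)
  apply/seteqP; split=> //; apply/AFRA_range_sub => //.
  by rewrite mx //; [apply/complete_D_complete|apply/AFRA_range_sub].
split=> [|S' cS']; first exact/complete_D_complete.
have UA' : [set a | S' (inl a)] `<=` args G.
  by case: cS' => [[[SE _] _] _] a /SE /elements_inl.
(* The competitor [S'] is an arbitrary complete extension; it must come from a set of arguments
   before Dung maximality can apply. *)
have S'E := complete_to_AFRA _ cS'.
rewrite S'E => sub; apply/seteqP; split=> //; apply/AFRA_range_sub => //.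
rewrite mx //; last exact/AFRA_range_sub.
by apply/(complete_D_complete _ UA'); rewrite -S'E.
Qed.

End AF.

Theorem proposition10 (T : Type) (G : afra T) (hG : is_AF G)
    (S : set (element T)) (hS : S `<=` elements G) :
  semi_stable G S <->
  exists U : set T,
    [/\ U `<=` args G, D_semi_stable G U & S = to_AFRA G U].
Proof.
split=> [ssS|[U [UA ssU ->]]]; last exact/semi_stable_to_AFRA.
have SA : [set a | S (inl a)] `<=` args G by move=> a /hS /elements_inl.
have SE := complete_to_AFRA hG S (proj1 ssS).
exists [set a | S (inl a)]; split=> //.
by apply/(semi_stable_to_AFRA hG _ SA); rewrite -SE.
Qed.
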